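(* Let $n\ge 1$ be an integer, let $T$ be a group automorphism of $\mathbb{Z}_n$, and let $X=\mathrm{Al}(\mathbb{Z}_n,T)$ be the corresponding linear Alexander quandle, with $m$ orbits. Then the map $$u\colon \mathrm{As}(X)\longrightarrow \mathbb{Z}^m\ltimes \mathbb{Z}_n,\qquad g\longmapsto (Ab(g),\omega(g))$$ is an injective group morphism, where $Ab\colon \mathrm{As}(X)\to\mathbb{Z}^m$ is the abelianization and $\omega$ is the weight map.
   Context: $\mathbb{Z}_n=\mathbb{Z}/n\mathbb{Z}$. For an abelian group $M$ and a group automorphism $T$ of $M$, the Alexander quandle $\mathrm{Al}(M,T)$ is the set $M$ with the operation $a\lhd b=Ta+(1-T)b$; it is called linear when $M=\mathbb{Z}_n$. The structure group of a quandle $X$ is $\mathrm{As}(X)=\langle e_a,\ a\in X\mid e_ae_b=e_be_{a\lhd b},\ a,b\in X\rangle$. It acts on $X$ on the right by $a\cdot e_b=a\lhd b$, and the orbits of $X$ are the orbits of this action. The degree morphism $\varepsilon\colon\mathrm{As}(X)\to\mathbb{Z}$ sends each generator $e_a$ to $1$. Let $\mathbb{Z}\ltimes M$ be the set $\mathbb{Z}\times M$ with the group law $(k,a)(l,b)=(k+l,T^la+b)$. There is a group morphism $f\colon \mathrm{As}(X)\to\mathbb{Z}\ltimes M$ with $f(e_a)=(1,a)$; its first component is $\varepsilon$, and its second component is by definition the weight map $\omega\colon\mathrm{As}(X)\to M$. The abelianization $\mathrm{As}(X)_{Ab}$ is identified with $\mathbb{Z}^m$, the free abelian group on the set of orbits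 of $X$, so that $Ab\colon \mathrm{As}(X)\to\mathbb{Z}^m$ sends $e_x$ to the basis element indexed by the orbit of $x$. The group $\mathbb{Z}^m\ltimes\mathbb{Z}_n$ is the set $\mathbb{Z}^m\times\mathbb{Z}_n$ with the group law $(v,a)(w,b)=(v+w,\,T^{|w|}a+b)$, where $|w|\in\mathbb{Z}$ is the sum of the coordinates of $w$. *)

(* Defs.v *)
(* boolp is used only to turn Prop-valued equivalence relations into boolean ones,
   so that their quotients can be formed. *)
From HB Require Import structures.
From mathcomp Require Import all_boot all_order all_algebra.
From mathcomp Require Import boolp.

Set Implicit Arguments.
Unset Strict Implicit.
Unset Printing Implicit Defensive.

Import GRing.Theory.
Local Open Scope ring_scope.
Local Open Scope quotient_scope.

(** * Groups given by generators and relations *)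

(* The letter (x, false) is the generator x, (x, true) its formal inverse. *)
Notation word X := (seq (X * bool)%type).

Definition word_inv (X : Type) (w : word X) : word X :=
  rev [seq (l.1, ~~ l.2) | l <- w].

Inductive pres_eq (X : Type) (R : word X -> word X -> Prop) :
    word X -> word X -> Prop :=
| pres_eq_refl u : pres_eq R u u
| pres_eq_sym u v : pres_eq R u v -> pres_eq R v u
| pres_eq_trans u v w : pres_eq R u v -> pres_eq R v w -> pres_eq R u w
| pres_eq_cat u u' v v' :
    pres_eq R u u' -> pres_eq R v v' -> pres_eq R (u ++ v) (u' ++ v')
| pres_eq_cancel x s : pres_eq R [:: (x, s); (x, ~~ s)] [::]
| pres_eq_rel u v : R u v -> pres_eq R u v.

Section Presentation.
Variables (X : choiceType) (R : word X -> word X -> Prop).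
Implicit Types u v w : word X.

Definition pres_eqb : rel (word X) := fun u v => `[< pres_eq R u v >].

Lemma pres_eqb_refl : reflexive pres_eqb.
Proof. by move=> u; apply/asboolP; exact: pres_eq_refl. Qed.

Lemma pres_eqb_sym : symmetric pres_eqb.
Proof. by move=> u v; apply/asboolP/asboolP; exact: pres_eq_sym. Qed.

Lemma pres_eqb_trans : transitive pres_eqb.
Proof.
move=> v u w /asboolP uv /asboolP vw; apply/asboolP; exact: pres_eq_trans uv vw.
Qed.

Canonical pres_equiv := EquivRel pres_eqb
  pres_eqb_refl pres_eqb_sym pres_eqb_trans.

Definition pres : Type := {eq_quot pres_equiv}.
HB.instance Definition _ := Choice.on pres.
HB.instance Definition _ := Quotient.on pres.

Definition pres_class (w : word X) : pres := \pi_pres w.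

Lemma pres_classP u v : pres_class u = pres_class v <-> pres_eq R u v.
Proof. by split=> [/eqquotP/asboolP//|uv]; apply/eqquotP/asboolP. Qed.

Lemma pres_reprK (g : pres) : pres_class (repr g) = g.
Proof. exact: reprK. Qed.

Lemma pres_repr u : pres_eq R (repr (pres_class u)) u.
Proof. by apply/pres_classP; rewrite pres_reprK. Qed.

Lemma word_inv_cat u v : word_inv (u ++ v) = word_inv v ++ word_inv u.
Proof. by rewrite /word_inv map_cat rev_cat. Qed.

Lemma word_invK : involutive (@word_inv X).
Proof.
move=> w; rewrite /word_inv map_rev revK -map_comp -[RHS]map_id.
by apply: eq_map => -[x s] /=; rewrite negbK.
Qed.

Lemma pres_eq_mulV w : pres_eq R (w ++ word_inv w) [::].
Proof.
elim: w => [|[x s] w IHw]; first exact: pres_eq_refl.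
rewrite -cat1s word_inv_cat -catA (catA w).
apply: pres_eq_trans (pres_eq_cancel R x s).
rewrite -[X in pres_eq _ _ X]/([:: (x, s)] ++ [:: (x, ~~ s)]).
by apply: pres_eq_cat (pres_eq_refl _ _) _;
   apply: pres_eq_cat IHw (pres_eq_refl _ _).
Qed.

Lemma pres_eq_Vmul w : pres_eq R (word_inv w ++ w) [::].
Proof. by rewrite -{2}(word_invK w); exact: pres_eq_mulV. Qed.

Definition pres_mul (g h : pres) : pres := pres_class (repr g ++ repr h).
Definition pres_inv (g : pres) : pres := pres_class (word_inv (repr g)).

Lemma pres_mulE u v : pres_mul (pres_class u) (pres_class v) = pres_class (u ++ v).
Proof. by apply/pres_classP; apply: pres_eq_cat; exact: pres_repr. Qed.

Lemma pres_mulA : associative pres_mul.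
Proof.
move=> g h k; rewrite -(pres_reprK g) -(pres_reprK h) -(pres_reprK k).
by rewrite !pres_mulE catA.
Qed.

Lemma pres_mul1 : left_id (pres_class [::]) pres_mul.
Proof. by move=> g; rewrite -(pres_reprK g) pres_mulE. Qed.

Lemma pres_mulr1 : right_id (pres_class [::]) pres_mul.
Proof. by move=> g; rewrite -(pres_reprK g) pres_mulE cats0. Qed.

Lemma pres_mulV : right_inverse (pres_class [::]) pres_inv pres_mul.
Proof.
move=> g; rewrite -{1}(pres_reprK g) pres_mulE; apply/pres_classP.
exact: pres_eq_mulV.
Qed.

Lemma pres_Vmul : left_inverse (pres_class [::]) pres_inv pres_mul.
Proof.
move=> g; rewrite -{2}(pres_reprK g) pres_mulE; apply/pres_classP.
exact: pres_eq_Vmul.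
Qed.

HB.instance Definition _ := isGroup.Build pres
  pres_mulA pres_mul1 pres_mulr1 pres_Vmul pres_mulV.

Definition pres_gen (x : X) : pres := pres_class [:: (x, false)].

End Presentation.

Definition letter_eval (X : Type) (G : groupType) (phi : X -> G) (l : X * bool) : G :=
  (if l.2 then (phi l.1)^-1 else phi l.1)%g.

Definition word_eval (X : Type) (G : groupType) (phi : X -> G) (w : word X) : G :=
  (\prod_(l <- w) letter_eval phi l)%g.

(* The morphism out of a presented group extending a map on generators that is
   compatible with the relations. *)
Definition pres_lift (X : choiceType) (R : word X -> word X -> Prop)
    (G : groupType) (phi : X -> G)
    (phiR : forall u v, R u v -> word_eval phi u = word_eval phi v)
    (g : pres R) : G :=
  word_eval phi (repr g).

Section PresLift.
Variables (X : choiceType) (R : word X -> word X -> Prop) (G : groupType).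
Variables (phi : X -> G).
Hypothesis phiR : forall u v, R u v -> word_eval phi u = word_eval phi v.

Lemma word_eval_cat u v :
  word_eval phi (u ++ v) = (word_eval phi u * word_eval phi v)%g.
Proof. by rewrite /word_eval big_cat. Qed.

Lemma word_eval_pres_eq u v : pres_eq R u v -> word_eval phi u = word_eval phi v.
Proof.
elim=> {u v} [//|u v _ ->|u v w _ -> _ ->|u u' v v' _ e1 _ e2|x s|u v /phiR] //.
- by rewrite !word_eval_cat e1 e2.
- rewrite /word_eval big_cons big_seq1 big_nil /letter_eval /=.
  by case: s => /=; rewrite ?mulVg ?mulgV.
Qed.

Lemma pres_lift_class w : pres_lift phiR (pres_class R w) = word_eval phi w.
Proof. by apply: word_eval_pres_eq; exact: pres_repr. Qed.

Lemma pres_lift_gen x : pres_lift phiR (pres_gen R x) = phi x.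
Proof. by rewrite pres_lift_class /word_eval big_seq1. Qed.

Lemma pres_lift_monoid_morphism : monoid.monoid_morphism (pres_lift phiR).
Proof.
split=> [|g h]; first by rewrite pres_lift_class /word_eval big_nil.
by rewrite -(pres_reprK g) -(pres_reprK h) [(_ * _)%g]pres_mulE
  !pres_lift_class word_eval_cat.
Qed.

End PresLift.

(** * Quandles *)

(* qop a b is a <| b: the translations (_ <| b) are bijective, with inverse
   qopV _ b, and distribute over the operation. *)
HB.mixin Record isQuandle X of Choice X := {
  qop : X -> X -> X;
  qopV : X -> X -> X;
  qopK : forall b, cancel (qop^~ b) (qopV^~ b);
  qopVK : forall b, cancel (qopV^~ b) (qop^~ b);
  qopxx : forall a, qop a a = a;
  qop_distr : forall a b c, qop (qop a b) c = qop (qop a c) (qop b c)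
}.

#[short(type="quandleType")]
HB.structure Definition Quandle := {X of isQuandle X & Choice X}.

#[short(type="finQuandleType")]
HB.structure Definition FinQuandle := {X of Quandle X & Finite X}.

Notation "a <| b" := (qop a b) (at level 40, left associativity) : ring_scope.

(** ** The structure group *)

Inductive As_rel (X : quandleType) : word X -> word X -> Prop :=
| AsRel (a b : X) :
    As_rel [:: (a, false); (b, false)] [:: (b, false); (a <| b, false)].

Definition As (X : quandleType) : Type := pres (@As_rel X).
HB.instance Definition _ (X : quandleType) := Group.on (As X).

Definition As_gen (X : quandleType) (a : X) : As X := pres_gen (@As_rel X) a.

Lemma As_genM (X : quandleType) (a b : X) :
  (As_gen a * As_gen b = As_gen b * As_gen (a <| b) :> As X)%g.
Proof.
rewrite /As_gen /pres_gen; rewrite ![(_ * _)%g]pres_mulE.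
by apply/pres_classP; apply: pres_eq_rel; exact: AsRel.
Qed.

Lemma As_rel_eval (X : quandleType) (G : groupType) (phi : X -> G) :
  (forall a b, phi a * phi b = phi b * phi (a <| b))%g ->
  forall u v, As_rel u v -> word_eval phi u = word_eval phi v.
Proof.
by move=> phiM _ _ [a b]; rewrite /word_eval !big_cons !big_nil /letter_eval /=
  !mulg1.
Qed.

Definition As_lift (X : quandleType) (G : groupType) (phi : X -> G)
    (phiM : forall a b, (phi a * phi b = phi b * phi (a <| b))%g) : As X -> G :=
  pres_lift (As_rel_eval phiM).

Lemma As_lift_gen (X : quandleType) (G : groupType) (phi : X -> G)
    (phiM : forall a b, (phi a * phi b = phi b * phi (a <| b))%g) a :
  As_lift phiM (As_gen a) = phi a.
Proof. exact: pres_lift_gen. Qed.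

Lemma As_lift_monoid_morphism (X : quandleType) (G : groupType) (phi : X -> G)
    (phiM : forall a b, (phi a * phi b = phi b * phi (a <| b))%g) :
  monoid.monoid_morphism (As_lift phiM).
Proof. exact: pres_lift_monoid_morphism. Qed.

(** ** The right action of the structure group, and its orbits *)

Definition letter_act (X : quandleType) (x : X) (l : X * bool) : X :=
  if l.2 then qopV x l.1 else x <| l.1.

Definition word_act (X : quandleType) (x : X) (w : word X) : X :=
  foldl (@letter_act X) x w.

Definition As_act (X : quandleType) (x : X) (g : As X) : X := word_act x (repr g).

Section Action.
Variable X : quandleType.
Implicit Types (x y a : X) (g h : As X) (u v w : word X).

Lemma word_act_cat x u v : word_act x (u ++ v) = word_act (word_act x u) v.
Proof. exact: foldl_cat. Qed.

Lemma word_act_pres_eq u v :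
  pres_eq (@As_rel X) u v -> forall x, word_act x u = word_act x v.
Proof.
elim=> {u v}
  [//|u v _ e x|u v w _ e1 _ e2 x|u u' v v' _ e1 _ e2 x|a [] x|_ _ [a b] x] //=.
- by rewrite e1.
- by rewrite !word_act_cat e1 e2.
- exact: qopVK.
- exact: qopK.
- exact: qop_distr.
Qed.

Lemma As_act_class x w : As_act x (pres_class (@As_rel X) w) = word_act x w.
Proof. by apply: word_act_pres_eq; exact: pres_repr. Qed.

Lemma As_act_gen x a : As_act x (As_gen a) = x <| a.
Proof. exact: As_act_class. Qed.

Lemma As_act1 x : As_act x 1%g = x.
Proof. exact: As_act_class. Qed.

Lemma As_actM x g h : As_act x (g * h)%g = As_act (As_act x g) h.
Proof.
rewrite -(pres_reprK g) -(pres_reprK h) [(_ * _)%g]pres_mulE.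
by rewrite !As_act_class word_act_cat.
Qed.

Definition same_orbit : rel X := fun x y => `[< exists g, As_act x g = y >].

Lemma same_orbit_refl : reflexive same_orbit.
Proof. by move=> x; apply/asboolP; exists 1%g; exact: As_act1. Qed.

Lemma same_orbit_sym : symmetric same_orbit.
Proof.
by move=> x y; apply/asboolP/asboolP => -[g <-]; exists (g^-1)%g;
  rewrite -As_actM mulgV As_act1.
Qed.

Lemma same_orbit_trans : transitive same_orbit.
Proof.
move=> y x z /asboolP[g <-] /asboolP[h <-]; apply/asboolP.
by exists (g * h)%g; exact: As_actM.
Qed.

Canonical same_orbit_equiv := EquivRel same_orbit
  same_orbit_refl same_orbit_sym same_orbit_trans.

Definition orbits : Type := {eq_quot same_orbit_equiv}.
HB.instance Definition _ := Choice.on orbits.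
HB.instance Definition _ := Quotient.on orbits.

Definition orbit_of x : orbits := \pi_orbits x.

Lemma orbit_ofP x y :
  orbit_of x = orbit_of y <-> exists g, As_act x g = y.
Proof. by split=> [/eqquotP/asboolP|xy] //; apply/eqquotP/asboolP. Qed.

Lemma orbit_of_qop x a : orbit_of (x <| a) = orbit_of x.
Proof. by apply/esym/orbit_ofP; exists (As_gen a); exact: As_act_gen. Qed.

End Action.

HB.instance Definition _ (X : finQuandleType) : isCountable (orbits X) :=
  CanIsCountable (@reprK _ (orbits X)).
HB.instance Definition _ (X : finQuandleType) : isFinite (orbits X) :=
  CanIsFinite (@reprK _ (orbits X)).

(** * The abelianization of the structure group *)

(* A copy of the additive group V carrying a (multiplicative) groupType structure. *)
Definition multiplicative (V : zmodType) : Type := V.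
HB.instance Definition _ (V : zmodType) := Choice.on (multiplicative V).
HB.instance Definition _ (V : zmodType) := isGroup.Build (multiplicative V)
  (@addrA V) (@add0r V) (@addr0 V) (@addNr V) (@addrN V).

(* Z^m, the m coordinates being indexed by the m orbits of X. *)
Definition Zorbits (X : finQuandleType) := {ffun orbits X -> int}.
HB.instance Definition _ (X : finQuandleType) := GRing.Zmodule.on (Zorbits X).

Definition orbit_basis (X : finQuandleType) (o : orbits X) : Zorbits X :=
  [ffun o' => (o' == o)%:R].

Definition coord_sum (X : finQuandleType) (v : Zorbits X) : int := \sum_o v o.

Fact coord_sum_zmod_morphism (X : finQuandleType) : zmod_morphism (@coord_sum X).
Proof.
by move=> v w; rewrite /coord_sum -sumrB; apply: eq_bigr => o _; rewrite !ffunE.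
Qed.
HB.instance Definition _ (X : finQuandleType) :=
  GRing.isZmodMorphism.Build (Zorbits X) int (@coord_sum X)
    (@coord_sum_zmod_morphism X).

Definition Ab_gen (X : finQuandleType) (x : X) : multiplicative (Zorbits X) :=
  orbit_basis (orbit_of x).

Fact Ab_genM (X : finQuandleType) (a b : X) :
  (Ab_gen a * Ab_gen b = Ab_gen b * Ab_gen (a <| b))%g.
Proof. by rewrite /Ab_gen orbit_of_qop; exact: addrC. Qed.

Definition Ab (X : finQuandleType) : As X -> Zorbits X := As_lift (@Ab_genM X).

Lemma Ab_As_gen (X : finQuandleType) (x : X) :
  Ab (As_gen x) = orbit_basis (orbit_of x).
Proof. exact: (As_lift_gen (@Ab_genM X) x). Qed.

Lemma AbM (X : finQuandleType) (g h : As X) : Ab (g * h)%g = Ab g + Ab h.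
Proof. exact: (As_lift_monoid_morphism (@Ab_genM X)).2. Qed.

(* The next two lemmas say that Ab is indeed the abelianization morphism: it is
   onto and every morphism from As X to an abelian group factors through it. *)
Section Abelianization.
Variable X : finQuandleType.

Lemma Ab1 : Ab (1%g : As X) = 0.
Proof. by apply: (addrI (Ab (1%g : As X))); rewrite -AbM mulg1 addr0. Qed.

Lemma AbV (g : As X) : Ab g^-1%g = - Ab g.
Proof. by apply: (addrI (Ab g)); rewrite -AbM mulgV Ab1 subrr. Qed.

Lemma Zorbits_basis (v : Zorbits X) : v = \sum_o orbit_basis o *~ v o.
Proof.
apply/ffunP => o; rewrite sum_ffunE (bigD1 o) //= big1 => [|o' o'o].
  by rewrite addr0 ffunMzE ffunE eqxx intz.
by rewrite ffunMzE ffunE eq_sym (negPf o'o) mul0rz.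
Qed.

Lemma Ab_surj (v : Zorbits X) : exists g : As X, Ab g = v.
Proof.
rewrite [v]Zorbits_basis.
apply: (big_ind (fun v => exists g : As X, Ab g = v)) => [|_ _ [g <-] [h <-]|o _].
- by exists 1%g; exact: Ab1.
- by exists (g * h)%g; exact: AbM.
have Mn k : exists g : As X, Ab g = orbit_basis o *+ k.
  elim: k => [|k [g gE]]; first by exists 1%g; exact: Ab1.
  exists (As_gen (repr o) * g)%g.
  by rewrite AbM gE Ab_As_gen mulrS /orbit_of reprK.
case: (v o) => k; first exact: Mn.
by have [g gE] := Mn k.+1; exists (g^-1)%g; rewrite AbV gE.
Qed.

Lemma Ab_factor (A : zmodType) (h : As X -> A) :
  (forall g k, h (g * k)%g = h g + h k) ->
  exists k : {additive Zorbits X -> A}, forall g, k (Ab g) = h g.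
Proof.
move=> hM.
have h1 : h 1%g = 0 by apply: (addrI (h 1%g)); rewrite -hM mulg1 addr0.
have hV g : h g^-1%g = - h g.
  by apply: (addrI (h g)); rewrite -hM mulgV h1 subrr.
have h_op x a : h (As_gen (x <| a)) = h (As_gen x).
  by apply: (addrI (h (As_gen a))); rewrite -hM -As_genM hM addrC.
have h_act w x : h (As_gen (word_act x w)) = h (As_gen x).
  elim: w x => //= -[a [|]] w IHw x; rewrite IHw /letter_act /= ?h_op //.
  by rewrite -(h_op _ a) qopVK.
have h_orbit x : h (As_gen (repr (orbit_of x))) = h (As_gen x).
  have /orbit_ofP[g <-] : orbit_of x = orbit_of (repr (orbit_of x)).
    by rewrite {2}/orbit_of reprK.
  by rewrite /As_act h_act.
pose k (v : Zorbits X) := \sum_(o : orbits X) h (As_gen (repr o)) *~ v o.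
have kB : zmod_morphism k.
  by move=> v w; rewrite /k -sumrB; apply: eq_bigr => o _; rewrite !ffunE mulrzBr.
pose kA := GRing.isZmodMorphism.Build _ _ k kB.
pose K : {additive Zorbits X -> A} := HB.pack k kA.
exists K => g.
have K_gen x : K (Ab (As_gen x)) = h (As_gen x).
  rewrite Ab_As_gen -[K _]/(k _) /k (bigD1 (orbit_of x)) //= big1 => [|o ox].
    by rewrite ffunE eqxx addr0 h_orbit.
  by rewrite ffunE (negPf ox).
rewrite -(pres_reprK g); elim: (repr g) => [|[x s] w IHw].
  by rewrite -[pres_class _ _]/(1%g : As X) Ab1 raddf0 h1.
rewrite -cat1s -pres_mulE -[pres_mul _ _]/(_ * _ : As X)%g hM AbM raddfD IHw.
congr (_ + _); case: s; last exact: K_gen.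
have -> : pres_class (@As_rel X) [:: (x, true)] = ((As_gen x)^-1)%g.
  apply: (mulgI (As_gen x : As X)); rewrite mulgV [LHS]pres_mulE.
  by apply/pres_classP; exact: (pres_eq_cancel _ x false).
by rewrite AbV raddfN K_gen hV.
Qed.

End Abelianization.

(** * Alexander quandles *)

(* aut_inv is determined by aut_fun; it is recorded to define negative powers. *)
Record zmod_aut (M : zmodType) := ZmodAut {
  aut_fun :> {additive M -> M};
  aut_inv : M -> M;
  aut_funK : cancel aut_fun aut_inv;
  aut_invK : cancel aut_inv aut_fun
}.

Definition aut_exp (M : zmodType) (T : zmod_aut M) (l : int) (a : M) : M :=
  match l with
  | Posz k => iter k T a
  | Negz k => iter k.+1 (aut_inv T) a
  end.

Section AutExp.
Variables (M : zmodType) (T : zmod_aut M).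

Lemma aut_inv_additive : zmod_morphism (aut_inv T).
Proof.
by move=> a b; apply: (can_inj (aut_funK T)); rewrite raddfB !aut_invK.
Qed.

Lemma aut_expB l : zmod_morphism (aut_exp T l).
Proof.
case: l => k a b /=; first by elim: k => //= k ->; rewrite raddfB.
by rewrite -!iterS; elim: k.+1 => //= j ->; rewrite aut_inv_additive.
Qed.

Lemma aut_exp0 l : aut_exp T l 0 = 0.
Proof. by have := aut_expB l 0 0; rewrite !subrr. Qed.

Lemma aut_expN l a : aut_exp T l (- a) = - aut_exp T l a.
Proof. by rewrite -[- a]sub0r aut_expB aut_exp0 sub0r. Qed.

Lemma aut_expD l a b : aut_exp T l (a + b) = aut_exp T l a + aut_exp T l b.
Proof. by rewrite -{1}[b]opprK aut_expB aut_expN opprK. Qed.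

Lemma aut_exp1D l a : aut_exp T (1 + l) a = T (aut_exp T l a).
Proof.
case: l => [k //|[|k]]; first by rewrite /= aut_invK.
have -> : 1 + Negz k.+1 = Negz k by rewrite !NegzE -[k.+2]addn1 PoszD opprD addrCA subrr addr0.
by rewrite /= aut_invK.
Qed.

Lemma aut_expBone l a : aut_exp T (l - 1) a = aut_inv T (aut_exp T l a).
Proof. by rewrite -{2}[l](subrKC 1) aut_exp1D aut_funK. Qed.

Lemma aut_exp_comp k l a : aut_exp T (k + l) a = aut_exp T k (aut_exp T l a).
Proof.
elim/int_rec: k => [|k IHk|k IHk]; first by rewrite add0r.
- by rewrite -add1n PoszD -addrA !aut_exp1D IHk.
- have -> : - k.+1%:Z = - k%:Z - 1 by rewrite -addn1 PoszD opprD.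
  by rewrite addrAC !aut_expBone IHk.
Qed.

End AutExp.

Definition alexander (M : zmodType) (T : zmod_aut M) : Type := M.

Section Alexander.
Variables (M : zmodType) (T : zmod_aut M).

HB.instance Definition _ := Choice.on (alexander T).

Definition alex_op (a b : M) : M := T a + (b - T b).
Definition alex_opV (a b : M) : M := aut_inv T (a - (b - T b)).

Fact alex_opK b : cancel (alex_op^~ b) (alex_opV^~ b).
Proof. by move=> a; rewrite /alex_opV /alex_op addrK aut_funK. Qed.

Fact alex_opVK b : cancel (alex_opV^~ b) (alex_op^~ b).
Proof. by move=> a; rewrite /alex_opV /alex_op aut_invK subrK. Qed.

Fact alex_opxx a : alex_op a a = a.
Proof. by rewrite /alex_op subrKC. Qed.

Fact alex_op_distr a b c :
  alex_op (alex_op a b) c = alex_op (alex_op a c) (alex_op b c).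
Proof.
rewrite /alex_op !(raddfB, raddfD) /= -!(addrA (T (T a))); congr (_ + _).
rewrite -[- T c - _]opprD; move: (T b) (T (T b)) (c - T c) (T c - T (T c)) => b1 b2 d e.
by rewrite addrACA addrCA subrKC.
Qed.

HB.instance Definition _ := isQuandle.Build (alexander T)
  alex_opK alex_opVK alex_opxx alex_op_distr.

End Alexander.

HB.instance Definition _ (M : finZmodType) (T : zmod_aut M) :=
  Finite.on (alexander T).

(** * Semidirect products *)

(* The group V * M with law (v, a)(w, b) = (v + w, T^(d w) a + b), for a degree
   morphism d : V -> Z; this is Z |x M for V = Z and d the identity, and Z^m |x M for
   V = Z^m and d the sum of the coordinates. *)
Definition semidirect (V M : zmodType) (d : {additive V -> int}) (T : zmod_aut M)
  : Type := (V * M)%type.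

Section Semidirect.
Variables (V M : zmodType) (d : {additive V -> int}) (T : zmod_aut M).

HB.instance Definition _ := Choice.on (semidirect d T).

Definition sd_mul (x y : semidirect d T) : semidirect d T :=
  (x.1 + y.1, aut_exp T (d y.1) x.2 + y.2).
Definition sd_one : semidirect d T := (0, 0).
Definition sd_inv (x : semidirect d T) : semidirect d T :=
  (- x.1, - aut_exp T (d (- x.1)) x.2).

Fact sd_mulA : associative sd_mul.
Proof.
move=> x y z; rewrite /sd_mul /= addrA; congr pair.
by rewrite raddfD [d y.1 + _]addrC aut_exp_comp aut_expD addrA.
Qed.

Fact sd_mul1 : left_id sd_one sd_mul.
Proof. by case=> v a; rewrite /sd_mul /= add0r aut_exp0 add0r. Qed.

Fact sd_mulr1 : right_id sd_one sd_mul.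
Proof. by case=> v a; rewrite /sd_mul /= addr0 raddf0 addr0. Qed.

Fact sd_mulV : right_inverse sd_one sd_inv sd_mul.
Proof. by case=> v a; rewrite /sd_mul /= !subrr. Qed.

Fact sd_Vmul : left_inverse sd_one sd_inv sd_mul.
Proof.
case=> v a; rewrite /sd_mul /= aut_expN -aut_exp_comp -raddfD subrr raddf0.
by rewrite !addNr.
Qed.

HB.instance Definition _ := isGroup.Build (semidirect d T)
  sd_mulA sd_mul1 sd_mulr1 sd_Vmul sd_mulV.

End Semidirect.

(** * The degree and the weight map *)

Section Weight.
Variables (M : zmodType) (T : zmod_aut M).

Definition degree_weight_gen (a : alexander T) : semidirect idfun T := (1, a).

Fact degree_weight_genM (a b : alexander T) :
  (degree_weight_gen a * degree_weight_gen b
   = degree_weight_gen b * degree_weight_gen (a <| b))%g.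
Proof.
congr pair; rewrite /=.
by rewrite [a <| b]/(T a + (b - T b)) addrCA subrKC.
Qed.

Definition degree_weight : As (alexander T) -> semidirect idfun T :=
  As_lift degree_weight_genM.

Definition degree (g : As (alexander T)) : int := (degree_weight g).1.
Definition weight (g : As (alexander T)) : M := (degree_weight g).2.

Lemma degree_weight_As_gen a : degree_weight (As_gen a) = (1, a).
Proof. exact: As_lift_gen. Qed.

Lemma weight_As_gen a : weight (As_gen a) = a.
Proof. by rewrite /weight degree_weight_As_gen. Qed.

Lemma weightM g h : weight (g * h)%g = aut_exp T (degree h) (weight g) + weight h.
Proof.
by rewrite /weight /degree_weight (As_lift_monoid_morphism degree_weight_genM).2.
Qed.

End Weight.

Definition Ab_weight (M : finZmodType) (T : zmod_aut M)
    (g : As (alexander T)) : semidirect (@coord_sum (alexander T)) T :=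
  (Ab g, weight g).

(* Main.v *)
Require Import Defs.
From mathcomp Require Import all_boot all_order all_algebra.
From HB Require Import structures.

(** Write e_a for the generators of the structure group G, f for the morphism
    (degree, weight) and N for the kernel of the degree.

    In any structure group, e_a g = g e_{a.g}. Hence, if a morphism out of G
    separates the generators, every element of its kernel fixes every a, commutes
    with every generator, and is central ([ker_central]). This applies to f, so
    the weight makes N a central extension of M. When M is cyclic, a central
    extension of M is abelian ([degree0_commute]); this is the only use of the
    cyclicity of M, and the rest holds for every finite M such that N is abelian.

    Now write N additively and put x_a = e_0^-1 e_a, an element of N of weight a.
    The relations of the quandle become
      x_{c + (1 - T) b} = x_c + x_{(1 - T) b}    ([ker_genD_shift]),
    so b |-> x_{(1 - T) b} is a morphism s : M -> N, and they also give
      e_0^-1 z e_0 = z - s(weight z)             ([ker_conjE]).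
    The orbits are the cosets of (1 - T) M. Therefore, modulo the image of s,
    conjugation by e_0 acts trivially on N and x_a depends only on the orbit of a:
    modulo the image of s, the element e_0^{- degree g} g of N is the image of
    Ab g under the additive map sending the basis vector of an orbit to x_r, for
    r a representative of this orbit ([untwist_normal_form]).

    Let finally Ab g = 0 and weight g = 0. The degree of g, which is the sum of
    the coordinates of Ab g, vanishes, so g itself is x_{(1 - T) y} for some y.
    Its weight (1 - T) y vanishes as well, and g = x_0 = 1. *)

Set Implicit Arguments.
Unset Strict Implicit.
Unset Printing Implicit Defensive.

Import GRing.Theory.
Local Open Scope ring_scope.
Local Open Scope group_scope.

(** * Structure groups and central kernels *)

Section StructureGroup.
Variable X : quandleType.

(** The equivalence in the second hypothesis covers the inverses of the
    generators too. *)
Lemma As_ind (P : As X -> Prop) :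
  P 1 -> (forall g a, P g <-> P (g * As_gen a)) -> forall g, P g.
Proof.
move=> P1 PM g; rewrite -(pres_reprK g).
elim/last_ind: (repr g) => [//|w [a s] IHw].
rewrite -cats1 -pres_mulE -[pres_mul _ _]/(_ * _ : As X).
case: s; last exact/(PM _ a).1.
apply/(PM _ a).2.
have -> : pres_class (@As_rel X) [:: (a, true)] = (As_gen a)^-1.
  apply: (mulgI (As_gen a : As X)); rewrite mulgV [LHS]pres_mulE.
  by apply/pres_classP; exact: (pres_eq_cancel _ a false).
by rewrite mulgVK.
Qed.

(** The defining relation is the case where g is a generator. *)
Lemma As_gen_mul a (g : As X) : As_gen a * g = g * As_gen (As_act a g).
Proof.
move: g a; apply: As_ind => [a|g b]; first by rewrite mul1g mulg1 As_act1.
have E a : g * As_gen b * As_gen (As_act a (g * As_gen b))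
           = g * As_gen (As_act a g) * As_gen b.
  by rewrite As_actM As_act_gen -!mulgA -As_genM.
split=> H a; first by rewrite E -H mulgA.
by apply: (mulIg (As_gen b)); rewrite -E -H mulgA.
Qed.

(** Apply f to e_a g = g e_{a.g}: since f g = 1, the generators e_a and e_{a.g}
    have the same image, so a.g = a and g commutes with e_a. *)
Lemma ker_central (G : groupType) (f : {multiplicative As X -> G}) :
  injective (fun a => f (As_gen a)) ->
  forall g h, f g = 1 -> commute g h.
Proof.
move=> f_inj g h fg1; move: h; apply: As_ind => [|h a]; first exact: commute1.
have ga : commute g (As_gen a).
  apply/esym; rewrite As_gen_mul; congr (g * As_gen _).
  apply: f_inj; apply: (mulgI (f g)).
  by rewrite -gmulfM -As_gen_mul gmulfM fg1 mul1g mulg1.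
split=> [gh|gha]; first exact: commuteM.
by rewrite -(mulgK (As_gen a) h); apply: commuteM => //; exact: commuteV.
Qed.

End StructureGroup.

(** * Degree and weight *)

HB.instance Definition _ (M : zmodType) (T : zmod_aut M) :=
  isUMagmaMorphism.Build (As (alexander T)) (semidirect idfun T)
    (@degree_weight M T) (As_lift_monoid_morphism _).

Section DegreeWeight.
Variables (M : zmodType) (T : zmod_aut M).
Implicit Types g h : As (alexander T).

Lemma alexander_qopE (a b : alexander T) : a <| b = (T a + (b - T b))%R :> M.
Proof. by []. Qed.

Lemma degreeM g h : degree (g * h) = (degree g + degree h)%R.
Proof. by rewrite /degree gmulfM. Qed.

Lemma degree1 : degree (1 : As (alexander T)) = 0%R.
Proof. by rewrite /degree gmulf1. Qed.

Lemma degreeV g : degree g^-1 = (- degree g)%R.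
Proof. by rewrite /degree gmulfV. Qed.

Lemma degree_gen a : degree (As_gen a : As (alexander T)) = 1%R.
Proof. by rewrite /degree degree_weight_As_gen. Qed.

Lemma weight1 : weight (1 : As (alexander T)) = 0%R.
Proof. by rewrite /weight gmulf1. Qed.

Lemma weightM0 g h : degree h = 0%R -> weight (g * h) = (weight g + weight h)%R.
Proof. by move=> h0; rewrite weightM h0. Qed.

Lemma weightV0 g : degree g = 0%R -> weight g^-1 = (- weight g)%R.
Proof. by rewrite /degree /weight gmulfV /= => ->; rewrite oppr0. Qed.

Lemma weight_gen0V : weight (@As_gen (alexander T) 0%R)^-1 = 0%R.
Proof. by rewrite /weight gmulfV /= degree_weight_As_gen aut_exp0 oppr0. Qed.

Lemma weightX0 g k : degree g = 0%R ->
  degree (g ^+ k) = 0%R /\ weight (g ^+ k) = (weight g *+ k)%R.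
Proof.
move=> g0; elim: k => [|k [d w]]; first by rewrite degree1 weight1.
by rewrite expgSr degreeM weightM0 // d g0 w mulrSr addr0.
Qed.

Lemma degree_weight_central g h :
  degree g = 0%R -> weight g = 0%R -> commute g h.
Proof.
move=> g0 w0; apply: (ker_central (f := @degree_weight M T)).
  by move=> a b /=; rewrite !degree_weight_As_gen => -[].
by rewrite /= [degree_weight g]surjective_pairing -[_.1]/(degree g)
           -[_.2]/(weight g) g0 w0.
Qed.

(** If z has degree 0 and a weight generating M, every element of degree 0 is a
    power of z times an element of degree 0 and weight 0, which is central. *)
Lemma degree0_commute :
  (exists c : M, forall a, exists k, a = (c *+ k)%R) ->
  forall g h, degree g = 0%R -> degree h = 0%R -> commute g h.
Proof.
move=> [c cM].
pose z : As (alexander T) := (@As_gen (alexander T) 0%R)^-1 * @As_gen (alexander T) c.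
have z0 : degree z = 0%R by rewrite degreeM degreeV !degree_gen addNr.
have wz : weight z = c by rewrite weightM weight_gen0V aut_exp0 add0r weight_As_gen.
have zX g : degree g = 0%R -> exists2 k, weight g = (c *+ k)%R &
    forall h, commute (z ^- k * g) h.
  move=> g0; have [k gk] := cM (weight g); exists k => // h.
  have [d w] := weightX0 k z0.
  apply: degree_weight_central; first by rewrite degreeM degreeV d g0 oppr0.
  by rewrite weightM0 // weightV0 // w wz gk addNr.
move=> g h /zX[k _ gC] /zX[l _ hC].
rewrite -(mulVKg (z ^+ k) g); apply: commute_sym.
apply: commuteM; last by apply: commute_sym; exact: gC.
rewrite -(mulVKg (z ^+ l) h); apply: commute_sym.
apply: commuteM; last by apply: commute_sym; exact: hC.
by apply: commuteX2; exact: commute_refl.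
Qed.

(** The step from x to x <| c adds (1 - T)(c - x). *)
Lemma orbit_shift (a b : alexander T) : orbit_of a = orbit_of b ->
  exists y : M, b = (a + (y - T y))%R :> M.
Proof.
move/orbit_ofP=> [g <-]; move: g; apply: As_ind => [|g c].
  by exists 0%R; rewrite As_act1 raddf0 subrr addr0.
rewrite As_actM As_act_gen; move: (As_act a g) => x.
have -> : x <| c = (x + ((c : M) - x - T ((c : M) - x)))%R :> M.
  by rewrite alexander_qopE raddfB [RHS]addrA subrKC opprB addrCA.
move: ((c : M) - x)%R => w; split=> -[y xE].
  exists (y + w)%R; rewrite xE raddfD opprD -addrA; congr (_ + _)%R.
  by rewrite addrACA.
exists (y - w)%R; apply: (addIr (w - T w))%R; rewrite xE raddfB opprB -addrA.
by congr (_ + _)%R; rewrite addrAC !subrKA.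
Qed.

End DegreeWeight.

(** * The kernel of the degree, as an additive group *)

(** The commutation hypothesis is a parameter of the type, so that the additive
    group structure declared below can be inferred from the type. *)
Definition degree_ker (M : zmodType) (T : zmod_aut M)
    (abT : forall g h : As (alexander T),
       degree g = 0%R -> degree h = 0%R -> commute g h) : Type :=
  {g : As (alexander T) | degree g == 0%R}.

Section DegreeKernel.
Variables (M : zmodType) (T : zmod_aut M).
Hypothesis abT : forall g h : As (alexander T),
  degree g = 0%R -> degree h = 0%R -> commute g h.

Local Notation N := (degree_ker abT).
Local Notation G := (As (alexander T)).

HB.instance Definition _ := Choice.copy N {g : G | degree g == 0%R}.
HB.instance Definition _ := SubType.copy N {g : G | degree g == 0%R}.

Implicit Types z w : N.

Definition in_ker (g : G) (g0 : degree g = 0%R) : N := exist _ g (introT eqP g0).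

Lemma ker_degree z : degree (val z) = 0%R. Proof. exact/eqP/(valP z). Qed.

Fact ker_add_proof z w : degree (val z * val w) = 0%R.
Proof. by rewrite degreeM !ker_degree. Qed.
Fact ker_opp_proof z : degree (val z)^-1 = 0%R.
Proof. by rewrite degreeV ker_degree. Qed.

Definition ker_zero : N := in_ker (degree1 T).
Definition ker_add z w : N := in_ker (ker_add_proof z w).
Definition ker_opp z : N := in_ker (ker_opp_proof z).

Fact ker_addA : associative ker_add.
Proof. by move=> z w t; apply: val_inj; exact: mulgA. Qed.
Fact ker_addC : commutative ker_add.
Proof. by move=> z w; apply: val_inj; apply: abT; exact: ker_degree. Qed.
Fact ker_add0 : left_id ker_zero ker_add.
Proof. by move=> z; apply: val_inj; exact: mul1g. Qed.
Fact ker_addN : left_inverse ker_zero ker_opp ker_add.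
Proof. by move=> z; apply: val_inj; exact: mulVg. Qed.

HB.instance Definition _ := GRing.isZmodule.Build N
  ker_addA ker_addC ker_add0 ker_addN.

Lemma ker_valD z w : val (z + w)%R = val z * val w. Proof. by []. Qed.
Lemma ker_valN z : val (- z)%R = (val z)^-1. Proof. by []. Qed.

Definition ker_weight z : M := weight (val z).

Fact ker_weightB : zmod_morphism ker_weight.
Proof.
move=> z w; rewrite /ker_weight ker_valD ker_valN.
by rewrite weightM0 ?ker_opp_proof // weightV0 ?ker_degree.
Qed.
HB.instance Definition _ := GRing.isZmodMorphism.Build N M ker_weight ker_weightB.

Local Notation e0 := (@As_gen (alexander T) 0%R).

Fact ker_gen_proof (a : M) : degree (e0^-1 * As_gen (a : alexander T)) = 0%R.
Proof. by rewrite degreeM degreeV !degree_gen addNr. Qed.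
Definition ker_gen (a : M) : N := in_ker (ker_gen_proof a).

Lemma ker_weight_gen a : ker_weight (ker_gen a) = a.
Proof.
by rewrite /ker_weight /= weightM weight_gen0V aut_exp0 add0r weight_As_gen.
Qed.

Lemma As_gen_ker_gen a : As_gen (a : alexander T) = e0 * val (ker_gen a).
Proof. by rewrite /= mulVKg. Qed.

Lemma ker_gen0 : ker_gen 0%R = 0%R.
Proof. by apply: val_inj; rewrite /= mulVg. Qed.

Definition ker_shift (b : M) : N := ker_gen (b - T b)%R.

(** Moving e_0 to the left turns x_a into x_{T a}, so that the relation between
    e_a and e_b reads x_{T a} + x_b = x_{T b} + x_{T a + (1 - T) b}. Its case
    a = 0 computes x_b - x_{T b} as x_{(1 - T) b}; take then T a = c. *)
Lemma ker_genD_shift c b : ker_gen (c + (b - T b))%R = (ker_gen c + ker_shift b)%R.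
Proof.
have rel a b' : (ker_gen (T a) + ker_gen b' =
                ker_gen (T b') + ker_gen (T a + (b' - T b')))%R.
  have E x : val (ker_gen x) * e0 = e0 * val (ker_gen (T x)).
    apply: (mulgI e0); rewrite mulgA -!As_gen_ker_gen As_genM.
    by rewrite alexander_qopE raddf0 subr0 addr0 As_gen_ker_gen.
  apply: val_inj; rewrite !ker_valD; apply: (mulgI e0); apply: (mulgI e0).
  have := As_genM (a : alexander T) b'.
  rewrite alexander_qopE (As_gen_ker_gen a) (As_gen_ker_gen b').
  rewrite (As_gen_ker_gen (_ + _)%R).
  have Ew x (w : G) : e0 * val (ker_gen x) * (e0 * w)
                      = e0 * (e0 * (val (ker_gen (T x)) * w)).
    by rewrite -mulgA (mulgA (val (ker_gen x))) E -mulgA.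
  by rewrite !Ew.
rewrite -(aut_invK T c); apply: (addrI (ker_gen (T b))).
rewrite -rel addrA [(ker_gen (T b) + _)%R]addrC -addrA; congr (_ + _)%R.
by have := rel 0%R b; rewrite raddf0 ker_gen0 !add0r.
Qed.

Fact ker_shiftB : zmod_morphism ker_shift.
Proof.
move=> a b; apply: (addIr (ker_shift b)); rewrite addrNK -ker_genD_shift.
rewrite /ker_shift raddfB; congr ker_gen.
by rewrite opprB addrAC !subrKA.
Qed.
HB.instance Definition _ := GRing.isZmodMorphism.Build M N ker_shift ker_shiftB.

Fact ker_conj_proof z : degree (val z ^ e0) = 0%R.
Proof. by rewrite /conjg !degreeM degreeV ker_degree add0r addNr. Qed.
Definition ker_conj z : N := in_ker (ker_conj_proof z).

(** From e_0 z = z e_{0.z}, the difference z - e_0^-1 z e_0 is x_{0.z}. Taking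
    weights identifies 0.z, since conjugation by e_0 acts as T on weights. *)
Lemma ker_conjE z : ker_conj z = (z - ker_shift (ker_weight z))%R.
Proof.
have E : (z - ker_conj z)%R = ker_gen (As_act (0%R : alexander T) (val z)).
  rewrite addrC; apply: val_inj; rewrite ker_valD ker_valN /= /conjg !invgM invgK.
  by rewrite -!mulgA As_gen_mul mulKg.
have W : ker_weight (ker_conj z) = T (ker_weight z).
  rewrite /ker_weight /= /conjg mulgA weightM weightM0 ?ker_degree //.
  by rewrite weight_gen0V weight_As_gen degree_gen add0r addr0.
have := congr1 ker_weight E; rewrite raddfB ker_weight_gen /= W => Ew.
by rewrite /ker_shift Ew -E opprB addrCA addrN addr0.
Qed.

End DegreeKernel.

(** * The normal form and the injectivity *)

Section FiniteAlexander.
Variables (M : finZmodType) (T : zmod_aut M).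
Hypothesis abT : forall g h : As (alexander T),
  degree g = 0%R -> degree h = 0%R -> commute g h.

Local Notation N := (degree_ker abT).
Local Notation G := (As (alexander T)).
Local Notation e0 := (@As_gen (alexander T) 0%R).

Definition e0_pow (k : int) : G :=
  match k with Posz k => e0 ^+ k | Negz k => e0 ^- k.+1 end.

Lemma e0_powS (k : int) : e0_pow (k + 1) = e0_pow k * e0.
Proof.
case: k => [k|[|k]]; first by rewrite -PoszD addn1 /= expgSr.
  by rewrite /= expg1 mulVg.
have -> : (Negz k.+1 + 1 = Negz k)%R by rewrite !NegzE -[k.+2]addn1 PoszD opprD addrNK.
by rewrite /= (expgS _ k.+1) invgM mulgVK.
Qed.

Lemma degree_e0_pow k : degree (e0_pow k) = k.
Proof.
have eX j : degree (e0 ^+ j) = j%:Z.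
  elim: j => [|j IHj]; first exact: degree1.
  by rewrite expgSr degreeM IHj degree_gen -PoszD addn1.
by case: k => j; rewrite /e0_pow ?degreeV eX ?NegzE.
Qed.

Fact untwist_proof (g : G) : degree ((e0_pow (degree g))^-1 * g) = 0%R.
Proof. by rewrite degreeM degreeV degree_e0_pow addNr. Qed.
Definition untwist (g : G) : N := in_ker abT (untwist_proof g).

Lemma untwist_gen (g : G) (a : alexander T) :
  untwist (g * As_gen a) = (ker_conj (untwist g) + ker_gen abT a)%R.
Proof.
apply: val_inj; rewrite ker_valD /= degreeM degree_gen e0_powS /conjg invgM.
by rewrite -!mulgA mulVKg.
Qed.

Definition ker_section (v : Zorbits (alexander T)) : N :=
  (\sum_(o : orbits (alexander T)) ker_gen abT (repr o) *~ v o)%R.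

Fact ker_sectionB : zmod_morphism ker_section.
Proof.
move=> v w; rewrite /ker_section -sumrB; apply: eq_bigr => o _.
by rewrite !ffunE mulrzBr.
Qed.
HB.instance Definition _ := GRing.isZmodMorphism.Build
  (Zorbits (alexander T)) N ker_section ker_sectionB.

Lemma ker_section_basis (o : orbits (alexander T)) :
  ker_section (orbit_basis o) = ker_gen abT (repr o).
Proof.
rewrite /ker_section (bigD1 o) //= big1 => [|o' o'o].
  by rewrite ffunE eqxx addr0.
by rewrite ffunE (negPf o'o).
Qed.

(** Multiplying g by e_a replaces the untwisted element by its conjugate by e_0,
    plus x_a: this adds the section of the orbit of a, up to a shift. *)
Lemma untwist_normal_form g :
  exists y, untwist g = (ker_section (Ab g) + ker_shift abT y)%R.
Proof.
move: g; apply: As_ind => [|g a].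
  exists 0%R; rewrite Ab1 !raddf0 addr0; apply: val_inj => /=.
  by rewrite degree1 invg1 mulg1.
have [b aE] : exists b, ker_gen abT a =
                        (ker_section (orbit_basis (orbit_of a)) + ker_shift abT b)%R.
  have [|b bE] := @orbit_shift _ T (repr (orbit_of a)) a.
    by rewrite /orbit_of reprK.
  by exists b; rewrite ker_section_basis -ker_genD_shift -bE.
rewrite untwist_gen ker_conjE AbM Ab_As_gen raddfD aE /=.
move: (ker_section (Ab g)) (ker_section (orbit_basis _)) (untwist g) => s t z.
have E w : (z - ker_shift abT w + (t + ker_shift abT b)
            = z + t + ker_shift abT (b - w))%R.
  by rewrite raddfB addrACA [(_ + ker_shift _ b)%R]addrC.
rewrite E; move: (b - _)%R => c.
split=> -[y zE].
  by exists (y + c)%R; rewrite zE raddfD /= [(s + _ + t)%R]addrAC addrA.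
exists (y - c)%R; apply: (addIr t); apply: (addIr (ker_shift abT c)).
by rewrite zE raddfB [(s + (_ - _) + t)%R]addrAC -[RHS]addrA addrNK.
Qed.

Lemma coord_sum_Ab (g : G) : coord_sum (Ab g) = degree g.
Proof.
move: g; apply: As_ind => [|g a]; first by rewrite Ab1 raddf0 degree1.
rewrite AbM raddfD Ab_As_gen degreeM degree_gen /=.
have -> : coord_sum (orbit_basis (orbit_of a)) = 1%R.
  rewrite /coord_sum (bigD1 (orbit_of a)) //= big1 => [|o oa].
    by rewrite ffunE eqxx addr0.
  by rewrite ffunE (negPf oa).
by split=> [->|/addIr].
Qed.

Lemma Ab_weight_ker (g : G) : Ab g = 0%R -> weight g = 0%R -> g = 1.
Proof.
move=> Ab0 w0.
have d0 : degree g = 0%R by rewrite -coord_sum_Ab Ab0 raddf0.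
have gE : val (untwist g) = g by rewrite /= d0 invg1 mul1g.
have [y] := untwist_normal_form g; rewrite Ab0 raddf0 add0r => uE.
have := congr1 (@ker_weight _ _ abT) uE.
rewrite {1}/ker_weight gE w0 ker_weight_gen => y0.
by rewrite -gE uE /ker_shift -y0 ker_gen0.
Qed.

Lemma Ab_weight_morphism : monoid.monoid_morphism (@Ab_weight M T).
Proof.
split=> [|g h]; first by congr pair; [exact: Ab1|exact: weight1].
congr pair; first exact: AbM.
by rewrite weightM -coord_sum_Ab.
Qed.
HB.instance Definition _ := isUMagmaMorphism.Build G
  (semidirect (@coord_sum (alexander T)) T) (@Ab_weight M T) Ab_weight_morphism.

Lemma Ab_weight_inj : injective (@Ab_weight M T).
Proof. by apply: gmulf_inj => g -[]; exact: Ab_weight_ker. Qed.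

End FiniteAlexander.

Theorem theorem2 (n : nat) (T : zmod_aut 'I_n.+1) :
  monoid.monoid_morphism (@Ab_weight 'I_n.+1 T) /\
  injective (@Ab_weight 'I_n.+1 T).
Proof.
split; first exact: Ab_weight_morphism.
apply: Ab_weight_inj; apply: degree0_commute.
(* 'I_n.+1 is a ring only for n > 0, whence inZp 1 as a generator. *)
exists (inZp 1) => a; exists (a : nat).
by apply: val_inj; rewrite Zp_mulrn /= modnMml mul1n modn_small.
Qed.
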